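(* For every integer $n\geq 1$, $$\sum_{\sigma\in \mathfrak{S}_n}(-1/q)^{\operatorname{exc} \sigma } q^{\operatorname{inv} \sigma} =\begin{cases} 0&\text{if $n$ is even},\\ (-1)^{\frac{n-1}{2}} \sum_{\sigma\in \mathfrak{A}_{n}} q^{ (31\text{-}2)\sigma + 2\,(2\text{-}13)\sigma}&\text{if $n$ is odd}; \end{cases}$$ and $$\sum_{\sigma\in \mathfrak{D}_n}(-1)^{\operatorname{exc} \sigma}q^{\operatorname{inv}\sigma} =\begin{cases} (-q)^{\frac{n}{2}} \sum_{\sigma\in \mathfrak{A}_{n}} q^{ (31\text{-}2)\sigma + 2\,(2\text{-}31)\sigma} &\text{if $n$ is even},\\ 0 &\text{if $n$ is odd}. \end{cases}$$
   Context: $\mathfrak{S}_n$ is the set of permutations $\sigma=\sigma_1\sigma_2\cdots\sigma_n$ of $[n]=\{1,\dots,n\}$, and $\mathfrak{D}_n\subseteq\mathfrak{S}_n$ is the set of derangements (permutations with no $i$ such that $\sigma_i=i$). $\mathfrak{A}_n$ is the set of falling alternating permutations in $\mathfrak{S}_n$, i.e. those with $\sigma_1>\sigma_2<\sigma_3>\sigma_4<\cdots$. For $\sigma\in\mathfrak{S}_n$: $\operatorname{exc}\sigma=\#\{i\in[n]:\sigma_i>i\}$; $\operatorname{inv}\sigma=\#\{(i,j):1\le i<j\le n,\ \sigma_i>\sigma_j\}$; $(31\text{-}2)\sigma=\#\{(i,j): i+1<j,\ \sigma_i>\sigma_j>\sigma_{i+1}\}$; $(2\text{-}31)\sigma=\#\{(i,j):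 j<i-1,\ \sigma_{i-1}>\sigma_j>\sigma_i\}$; $(2\text{-}13)\sigma=\#\{(i,j): j<i-1,\ \sigma_{i-1}<\sigma_j<\sigma_i\}$. *)

(* Defs.v *)
From mathcomp Require Import all_boot all_order all_algebra all_fingroup.
Set Implicit Arguments. Unset Strict Implicit. Unset Printing Implicit Defensive.

(* Permutations of [n] are represented by 'S_n = {perm 'I_n}, i.e. 0-indexed:
   position k (0 <= k < n) corresponds to position k+1 in the paper, and value
   s k to value (s k)+1.  All statistics below are invariant under this shift. *)

(* value of s at (nat) position k; 0 if k is out of range (never used then) *)
Definition pv n (s : 'S_n) (k : nat) : nat :=
  if insub k is Some i then nat_of_ord (s i) else 0.

Definition exc n (s : 'S_n) : nat := #|[set i : 'I_n | i < s i]|.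

Definition invnum n (s : 'S_n) : nat :=
  #|[set p : 'I_n * 'I_n | (p.1 < p.2) && (s p.2 < s p.1)]|.

Definition pat31_2 n (s : 'S_n) : nat :=
  #|[set p : 'I_n * 'I_n |
     [&& p.1.+1 < p.2, s p.2 < s p.1 & pv s p.1.+1 < s p.2]]|.

Definition pat2_31 n (s : 'S_n) : nat :=
  #|[set p : 'I_n * 'I_n |
     [&& p.2.+1 < p.1, s p.2 < pv s p.1.-1 & s p.1 < s p.2]]|.

Definition pat2_13 n (s : 'S_n) : nat :=
  #|[set p : 'I_n * 'I_n |
     [&& p.2.+1 < p.1, pv s p.1.-1 < s p.2 & s p.2 < s p.1]]|.

(* falling alternating: s_1 > s_2 < s_3 > s_4 < ... (1-indexed);
   0-indexed: for even k, s_k > s_{k+1}; for odd k, s_k < s_{k+1} *)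
Definition falt n (s : 'S_n) : bool :=
  [forall i : 'I_n, (i.+1 < n) ==>
     (if odd i then s i < pv s i.+1 else pv s i.+1 < s i)].

Definition derangement n (s : 'S_n) : bool := [forall i : 'I_n, s i != i].

(* Main.v *)
Require Import Defs.
From mathcomp Require Import all_boot all_order all_algebra all_fingroup.
From mathcomp Require Import zify ring.
From Stdlib Require Import Btauto.
Set Implicit Arguments. Unset Strict Implicit. Unset Printing Implicit Defensive.
Import GRing.Theory.

(* All four sums are sums over weighted Dyck paths.

   The sums over permutations are q-permanents sum_s q^(inv s) prod_i M i (s i).
   Read the rows and columns in order, leaving each new line either matched to
   an earlier open line or open itself: with a open rows and b open columns
   their a x b block vanishes, so an expansion along the new line contributes a
   fixed power of q.  One row and one column together give a Motzkin step; the
   weight of the level steps is proportional to 1 + x q (for the first sum,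
   where column k+1 is paired with row k) or to 1 + x (for derangements), and
   vanishes at x = -1/q, respectively x = -1.

   In an alternating word, replace every maximal run of letters >= k by a single
   block.  Going from k to k+1, the letter k either replaces a block (it is a
   peak) or splits one in two (it is a valley), and its contribution to the
   pattern statistics depends only on the number of blocks on either side of it.
   Even lengths are reduced to odd ones by appending a letter larger than all
   others.  The two path weights differ by a gauge factor. *)

(** * q-permanents *)

Lemma invnumV n (s : 'S_n) : invnum s^-1 = invnum s.
Proof.
rewrite /invnum.
rewrite -(card_imset [set p : 'I_n * 'I_n | (p.1 < p.2) && (s p.2 < s p.1)]
           (f := fun p => (s p.2, s p.1))); last first.
  by move=> [a b] [c d] /= [] /perm_inj -> /perm_inj ->.
apply: eq_card => -[a b]; rewrite inE /=; apply/idP/imsetP.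
  move=> /andP[ab ba]; exists ((s^-1)%g b, (s^-1)%g a); last by rewrite /= !permKV.
  by rewrite inE /= !permKV ab ba.
by case=> -[c d]; rewrite inE /= => /andP[cd dc] [-> ->]; rewrite !permK cd dc.
Qed.

Lemma invnum_sum n (s : 'S_n) :
  invnum s = (\sum_(i < n) \sum_(j < n) ((i < j) && (s j < s i)))%N.
Proof.
rewrite /invnum -sum1dep_card pair_big /= big_mkcond /=.
by apply: eq_bigr => -[i j] _ /=; case: ifP.
Qed.

Lemma card_ord_lt m k : (k <= m)%N -> (\sum_(i < m) (i < k))%N = k.
Proof.
move=> km; have -> : (\sum_(i < m) (i < k) = \sum_(i < m | i < k) 1)%N.
  by rewrite [RHS]big_mkcond; apply: eq_bigr => i _; case: ltnP.
by rewrite -(big_ord_widen m (fun=> 1%N) km) sum1_card card_ord.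
Qed.

Lemma inv_new_row a i j u : ((i < a) -> (j <= u)) ->
  (a < bump a i) && (bump j u < j) = (u < j).
Proof. by rewrite /bump; case: (leqP a i) => ai; case: (leqP j u) => ju /=; lia. Qed.

Lemma inv_new_col a i j u : ((i < a) -> (j <= u)) ->
  (bump a i < a) && (j < bump j u) = (i < a).
Proof. by rewrite /bump; case: (leqP a i) => ai; case: (leqP j u) => ju /=; lia. Qed.

Lemma ltn_bump2 h i j : (bump h i < bump h j) = (i < j).
Proof. by rewrite !ltnNge leq_bump2. Qed.

(** All values below [j] then sit in rows after [a], so the new entry forms an inversion with each
    of the [a] earlier rows and with each of the [j] smaller values. *)
Lemma invnum_lift n (a j : 'I_n.+1) (t : 'S_n) :
  (forall i : 'I_n, (i < a)%N -> (j <= t i)%N) ->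
  invnum (lift_perm a j t) = (invnum t + (a + j))%N.
Proof.
move=> hij; rewrite !invnum_sum.
rewrite (bigD1_ord a) //= (bigD1_ord a) //= ltnn add0n.
have -> : (\sum_(i < n) ((a < lift a i) &&
    (lift_perm a j t (lift a i) < lift_perm a j t a)) = j)%N.
  rewrite -[RHS](@card_ord_lt n j); last by rewrite -ltnS.
  rewrite [RHS](reindex_inj (@perm_inj _ t)); apply: eq_bigr => i _.
  by rewrite lift_perm_id lift_perm_lift /= inv_new_row //; apply: hij.
have -> : (\sum_(i < n) \sum_(k < n.+1) ((lift a i < k) &&
      (lift_perm a j t k < lift_perm a j t (lift a i))) =
   \sum_(i < n) ((i < a) + \sum_(k < n) ((i < k) && (t k < t i))))%N.
  apply: eq_bigr => i _; rewrite (bigD1_ord a) //= lift_perm_id !lift_perm_lift /=.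
  congr (_ + _)%N.
    by rewrite inv_new_col //; apply: hij.
  by apply: eq_bigr => k _; rewrite lift_perm_lift /= !ltn_bump2.
rewrite big_split /= card_ord_lt; last by rewrite -ltnS.
by rewrite addnA addnC (addnC j).
Qed.

Local Open Scope ring_scope.

Section QPermanent.
Variables (R : comNzRingType) (q : R).
Implicit Types (M : nat -> nat -> R) (g : nat -> nat -> R).

Definition qperm N M := \sum_(s : 'S_N) q ^+ invnum s * \prod_(i < N) M i (s i).

Definition qnat k : R := \sum_(i < k) q ^+ i.

Lemma eq_qperm N M1 M2 : (forall i j, (i < N)%N -> (j < N)%N -> M1 i j = M2 i j) ->
  qperm N M1 = qperm N M2.
Proof.
by move=> e; apply: eq_bigr => s _; congr (_ * _); apply: eq_bigr => i _; apply: e.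
Qed.

Lemma qperm_trmx N M : qperm N (fun i j => M j i) = qperm N M.
Proof.
rewrite /qperm (reindex_inj invg_inj) /=; apply: eq_bigr => s _.
rewrite invnumV; congr (_ * _); rewrite (reindex_inj (@perm_inj _ s)) /=.
by apply: eq_bigr => i _; rewrite permK.
Qed.

Lemma qperm_expand N M (a : 'I_N.+1) :
  qperm N.+1 M = \sum_(j < N.+1) M a j *
    \sum_(t : 'S_N) q ^+ invnum (lift_perm a j t) *
       \prod_(i < N) M (lift a i) (lift j (t i)).
Proof.
rewrite /qperm (partition_big (fun s : 'S_N.+1 => s a) xpredT) //=.
apply: eq_bigr => j _; rewrite big_distrr /=.
rewrite (reindex (lift_perm a j)) /=; last first.
  (* [ulsf i s] deletes row [i] and its value from [s]; this inverts [lift_perm]. *)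
  pose ulsf i (s : 'S_N.+1) k := odflt k (unlift (s i) (s (lift i k))).
  have ulsfK i (s : 'S_N.+1) k : lift (s i) (ulsf i s k) = s (lift i k).
    rewrite /ulsf; have:= neq_lift i k.
    by rewrite -(can_eq (permK s)) => /unlift_some[] ? ? ->.
  have inj_ulsf : injective (ulsf a _).
    move=> s; apply: can_inj (ulsf (s a) s^-1%g) _ => k'.
    by rewrite {1}/ulsf ulsfK !permK liftK.
  exists (fun s => perm (inj_ulsf s)) => [s _ | s].
    by apply/permP=> k'; rewrite permE /ulsf lift_perm_lift lift_perm_id liftK.
  move/(s _ =P _) => si; apply/permP=> k.
  case: (unliftP a k) => [k'|] ->; rewrite ?lift_perm_id //.
  by rewrite lift_perm_lift -si permE ulsfK.
apply: eq_big => [t|t _]; first by rewrite lift_perm_id eqxx.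
rewrite (bigD1_ord a) //= lift_perm_id mulrCA; congr (_ * (_ * _)).
by apply: eq_bigr => i _; rewrite lift_perm_lift.
Qed.

(* Rows below [a] and columns below [b] are the open lines; [g] is the part of
   the matrix whose rows and columns are both still unread. *)
Definition board (x z : R) g a b i j : R :=
  if (i < a)%N then (if (j < b)%N then 0 else x)
  else if (j < b)%N then z else g (i - a)%N (j - b)%N.

Lemma qperm_board_trmx x z g a b N :
  qperm N (board x z g a b) = qperm N (board z x (fun i j => g j i) b a).
Proof.
rewrite -qperm_trmx; apply: eq_qperm => i j _ _; rewrite /board.
by do 2 case: ltnP.
Qed.

(* If [M'] vanishes on the rows < a and columns < j, then every permutation with a
   nonzero product sends the first [a] rows to columns >= j, so that the entry
   [(a, j)] is involved in exactly [a + j] inversions. *)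
Lemma board_minor x z g a b N (j : 'I_N.+1) (ha : (a < N.+1)%N) M' :
  (forall i l, (i < N)%N -> (l < N)%N -> board x z g a b (bump a i) (bump j l) = M' i l) ->
  (forall i l, (i < a)%N -> (l < j)%N -> M' i l = 0) ->
  \sum_(t : 'S_N) q ^+ invnum (lift_perm (Ordinal ha) j t) *
     \prod_(i < N) board x z g a b (lift (Ordinal ha) i) (lift j (t i))
  = q ^+ (a + j) * qperm N M'.
Proof.
move=> hM h0; rewrite /qperm big_distrr /=; apply: eq_bigr => t _.
have -> : \prod_(i < N) board x z g a b (bump a i) (bump j (t i)) = \prod_(i < N) M' i (t i).
  by apply: eq_bigr => i _; rewrite hM.
case: (boolP [forall i : 'I_N, (i < a)%N ==> (j <= t i)%N]) => [/forallP h|].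
  rewrite invnum_lift => [|i ia]; last exact: implyP (h i) ia.
  by rewrite /= exprD; ring.
rewrite negb_forall => /existsP[i]; rewrite negb_imply -ltnNge => /andP[ia ji].
by rewrite (bigD1 i) //= h0 // !mul0r !mulr0.
Qed.

(** Linearity in row [a]: it is the row of a newly opened line (0 on the [b] open columns, [x]
    elsewhere), plus [z] on each open column, plus [y - x] in column [b]. [board_minor] evaluates
    the corrections. Column [b] exists only if [b <= N]; otherwise its correction has to be zero. *)
Lemma qperm_row x z y g a b N : (a <= N)%N -> (b <= N.+1)%N -> (b <= N)%N \/ y = x ->
  g 0%N 0%N = y -> (forall j, g 0%N j.+1 = x) ->
  qperm N.+1 (board x z g a b) =
     z * q ^+ a * qnat b * qperm N (board x z (fun i => g i.+1) a b.-1)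
   + (y - x) * q ^+ (a + b) * qperm N (board x z (fun i j => g i.+1 j.+1) a b)
   + qperm N.+1 (board x z (fun i => g i.+1) a.+1 b).
Proof.
move=> aN bN bNyx g00 g0S.
have aN1 : (a < N.+1)%N by [].
pose A := Ordinal aN1.
rewrite (qperm_expand _ A) (qperm_expand (board x z (fun i => g i.+1) a.+1 b) A).
set X := (X in _ = _ + X).
pose Q (j : 'I_N.+1) := \sum_(t : 'S_N) q ^+ invnum (lift_perm A j t) *
     \prod_(i < N) board x z g a b (lift A i) (lift j (t i)).
(* The two boards differ only in row [a], so they share the minors [Q] along it. *)
have -> : X = \sum_(j < N.+1) (if (j < b)%N then 0 else x) * Q j.
  apply: eq_bigr => j _; congr (_ * _); first by rewrite /board /= ltnSn.
  apply: eq_bigr => t _; congr (_ * _); apply: eq_bigr => i _.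
  rewrite /board /= /bump; case: (leqP a i) => ai.
    have -> : (1 + i < a.+1)%N = false by lia.
    have -> : (1 + i < a)%N = false by lia.
    have -> : (1 + i - a = (1 + i - a.+1).+1)%N by lia.
    by [].
  have -> : (0 + i < a.+1)%N by lia.
  by have -> : (0 + i < a)%N by lia.
apply/eqP; rewrite -subr_eq -sumrB; apply/eqP.
have -> : \sum_(j < N.+1) (board x z g a b A j * Q j - (if (j < b)%N then 0 else x) * Q j)
   = \sum_(j < N.+1 | (j < b)%N) z * Q j
     + (y - x) * (if (b <= N)%N then Q (inord b) else 0).
  rewrite (bigID (fun j : 'I_N.+1 => (j < b)%N)) /=; congr (_ + _).
    by apply: eq_bigr => j jb; rewrite /board /= ltnn jb; ring.
  case: bNyx => [bN' | yx]; last first.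
    rewrite yx subrr mul0r big1 // => j jb.
    rewrite /board /= ltnn (negbTE jb) subnn.
    by case: (j - b)%N => [|k]; rewrite ?g00 ?g0S ?yx subrr.
  rewrite bN' (bigD1 (inord b)) /=; last by rewrite inordK // ltnn.
  rewrite big1 ?addr0 => [|j /andP[jb jnb]].
    by rewrite /board /= ltnn inordK // ltnn !subnn g00; ring.
  rewrite /board /= ltnn (negbTE jb) subnn.
  have : (nat_of_ord j != b) by apply: contra jnb => /eqP <-; rewrite inord_val.
  move=> jb'; have -> : (j - b = (j - b).-1.+1)%N by lia.
  by rewrite g0S subrr.
congr (_ + _).
  rewrite -big_distrr /= -!mulrA; congr (_ * _).
  have distr (P : R) : q ^+ a * (qnat b * P) = \sum_(j < N.+1 | (j < b)%N) q ^+ (a + j) * P.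
    rewrite -(big_ord_widen N.+1 (fun j => q ^+ (a + j) * P)); last by [].
    by rewrite /qnat mulrA mulr_sumr mulr_suml; apply: eq_bigr => j _; rewrite exprD.
  rewrite distr.
  apply: eq_bigr => j jb.
  rewrite /Q (@board_minor _ _ _ _ _ _ _ _ (board x z (fun i => g i.+1) a b.-1)).
  - by [].
  - move=> i l iN lN; rewrite /board /bump.
    have -> : ((a <= i) + i < a)%N = (i < a)%N by lia.
    have -> : ((j <= l) + l < b)%N = (l < b.-1)%N by lia.
    case: ltnP => ia //; case: ltnP => lb //.
    by congr g; lia.
  - by move=> i l ia lj; rewrite /board ia; have -> : (l < b.-1)%N by lia.
rewrite -mulrA; case: bNyx => [bN' | ->]; last by rewrite subrr !mul0r.
congr (_ * _); rewrite bN' /Q.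
rewrite (@board_minor _ _ _ _ _ _ _ _ (board x z (fun i j => g i.+1 j.+1) a b)).
- by rewrite inordK.
- move=> i l iN lN; rewrite /board /bump inordK //.
  have -> : ((a <= i) + i < a)%N = (i < a)%N by lia.
  have -> : ((b <= l) + l < b)%N = (l < b)%N by lia.
  case: ltnP => ia //; case: ltnP => lb //.
  by congr g; lia.
- by move=> i l ia; rewrite inordK // => lj; rewrite /board ia lj.
Qed.

Lemma qperm_col x z y g a b N : (a <= N.+1)%N -> (b <= N)%N -> (a <= N)%N \/ y = z ->
  g 0%N 0%N = y -> (forall i, g i.+1 0%N = z) ->
  qperm N.+1 (board x z g a b) =
     x * q ^+ b * qnat a * qperm N (board x z (fun i j => g i j.+1) a.-1 b)
   + (y - z) * q ^+ (a + b) * qperm N (board x z (fun i j => g i.+1 j.+1) a b)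
   + qperm N.+1 (board x z (fun i j => g i j.+1) a b.+1).
Proof.
move=> aN bN aNyz g00 gS0; rewrite !(qperm_board_trmx x z) addnC.
by rewrite (@qperm_row z x y (fun i j => g j i)).
Qed.

End QPermanent.

(** * Dyck path expansion of the q-permanents *)

Section LeftHandSides.
Variables (R : comNzRingType) (q : R).

Lemma qnat0 : qnat q 0 = 0.
Proof. by rewrite /qnat big_ord0. Qed.

Lemma qnatS k : qnat q k.+1 = qnat q k + q ^+ k.
Proof. by rewrite /qnat big_ord_recr. Qed.

Lemma qperm1 M : qperm q 1 M = M 0%N 0%N.
Proof.
rewrite /qperm (big_pred1 1%g) => [|s]; last first.
  by apply/esym/eqP/permP => i; rewrite !ord1.
rewrite big_ord1 perm1 /invnum.
rewrite (_ : [set p : 'I_1 * 'I_1 | _] = set0) ?cards0 ?mul1r //.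
by apply/setP => -[i j]; rewrite !inE !ord1.
Qed.

Lemma qperm0 M : qperm q 0 M = 1.
Proof.
rewrite /qperm (big_pred1 1%g) => [|s]; last first.
  by apply/esym/eqP/permP => -[].
rewrite big_ord0 mulr1 /invnum.
rewrite (_ : [set p : 'I_0 * 'I_0 | _] = set0) ?cards0 //.
by apply/setP => -[[]].
Qed.

Lemma qperm_row0 N M : (forall j, (j < N.+1)%N -> M 0%N j = 0) -> qperm q N.+1 M = 0.
Proof.
move=> M0; rewrite /qperm big1 // => s _.
by rewrite big_ord_recl M0 // mul0r mulr0.
Qed.

(** Two of the four combinations keep the level: matching the row to an open column and opening the
    next column, or opening the row and matching the column to an open row. Their weights q^h [h+1]
    and x q^(h+1) [h+1] cancel because x q = -1. *)
Lemma qperm_weak_step x h N (g := fun i j => if (i <= j)%N then x else 1) :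
  x * q = -1 -> (h < N)%N ->
  qperm q N.+1 (board x 1 g h h.+1) =
    x * q ^+ h.*2 * qnat q h * qnat q h.+1 * qperm q N.-1 (board x 1 g h.-1 h)
  + qperm q N.+1 (board x 1 g h.+1 h.+2).
Proof.
move=> xq; case: N => // N hN.
pose g' := fun i j => if (i < j)%N then x else 1.
have step b M : (b <= M)%N -> qperm q M.+1 (board x 1 g' b b) =
    x * q ^+ b * qnat q b * qperm q M (board x 1 g b.-1 b)
  + qperm q M.+1 (board x 1 g b b.+1).
  move=> bM; rewrite (@qperm_col R q x 1 1 g') // ?leqW //; last by right.
  by rewrite subrr !mul0r addr0.
rewrite (@qperm_row R q x 1 x g) // ?(ltnW hN) ?(leqW hN) //; [|by right].
rewrite subrr !mul0r addr0 !step //=.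
have xq' : x * q ^+ h.+1 = - q ^+ h by rewrite exprS mulrA xq mulN1r.
by rewrite xq' -addnn exprD; ring.
Qed.

(** The level terms are q^h [h] (row matched, column opened), q^(2h) (correction at the zero
    diagonal entry) and -q^h [h+1] (row opened, column matched); they add up to zero. *)
Lemma qperm_derangement_step h N
    (g := fun i j => if (i < j)%N then -1 else if i == j then 0 else 1) :
  (h <= N)%N ->
  qperm q N.+1 (board (-1) 1 g h h) =
    - q ^+ (h.*2.-1) * qnat q h ^+ 2 * qperm q N.-1 (board (-1) 1 g h.-1 h.-1)
  + qperm q N.+1 (board (-1) 1 g h.+1 h.+1).
Proof.
move=> hN.
pose g1 := fun i j => g i.+1 j.
have colS a b M : (a <= M.+1)%N -> (b <= M)%N -> qperm q M.+1 (board (-1) 1 g1 a b) =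
   - q ^+ b * qnat q a * qperm q M (board (-1) 1 g a.-1 b)
   + qperm q M.+1 (board (-1) 1 g a b.+1).
  move=> aM bM; rewrite (@qperm_col R q (-1) 1 1 g1) //; last by right.
  by rewrite subrr !mul0r addr0 mulN1r.
rewrite (@qperm_row R q (-1) 1 0 g) // ?leqW //; last by left.
rewrite -/g1 colS //=.
case: h hN => [|h] hN.
  by rewrite /= !qnat0 qnatS qnat0; ring.
case: N hN => // N hN; rewrite colS //.
have e2 : q ^+ (h.+1 + h.+1) = q ^+ h.+1 * q ^+ h.+1 by rewrite exprD.
have e1 : q ^+ (h.+1).*2.-1 = q ^+ h.+1 * q ^+ h by rewrite doubleS /= -addnn -exprD addSn.
by rewrite e2 e1 (qnatS h.+1) /=; ring.
Qed.


(* [m] is the number of blocks and [r] the number of letters to come; [e] is the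
   number of blocks that must survive. *)
Fixpoint ladder (e : nat) (m r : nat) : R :=
  if r is r'.+1 then
    q ^+ m.-1 * qnat q m * ladder e m.+1 r'
    + q ^+ (m.-1 - e) * qnat q (m - e) * ladder e m.-1 r'
  else (m == e)%:R.

(* Up steps from [h] weigh 1 for the q-permanents, but q^h [h+1] in [ladder]. *)
Definition gauge h : R := \prod_(k < h) (q ^+ k * qnat q k.+1).

Lemma gaugeS h : gauge h.+1 = gauge h * (q ^+ h * qnat q h.+1).
Proof. by rewrite /gauge big_ord_recr. Qed.

(** The down weight x q^(2h) [h] [h+1] equals -(q^(h-1) [h]) (q^h [h+1]). The first factor turns
    [gauge] at h-1 into [gauge] at h, the second is the down weight of [ladder], and each down step
    leaves a sign. *)
Lemma qperm_weak_ladder x L h : x * q = -1 ->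
  qperm q (h.+1 + L) (board x 1 (fun i j => if (i <= j)%N then x else 1) h h.+1)
  = (-1) ^+ (h + L)./2 * gauge h * ladder 0 h.+1 L.+1.
Proof.
move=> xq; elim: L h => [|L IH] h.
  case: h => [|h].
    by rewrite qperm1 /board /gauge /= big_ord0 qnatS qnat0; ring.
  (* No column is unread, so an open row is zero throughout. *)
  rewrite addn0 qperm_row0 => [|j jh]; last by rewrite /board ltn0Sn jh.
  by rewrite /=; ring.
rewrite addnS qperm_weak_step ?leq_addr //.
have -> : (h.+1 + L).+1 = (h.+2 + L)%N by [].
rewrite IH -[in RHS](addSnnS h L) [in RHS]/ladder -/ladder !subn0 /=.
(* From [h = 0] the ladder may drop to 0 blocks, but with letters left its next weights are [0] =
   0. *)
case: h => [|h]; first by rewrite !qnat0 gaugeS /=; ring.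
rewrite IH !gaugeS !subn0.
have e : x * q ^+ (h.+1).*2 = - (q ^+ h * q ^+ h.+1).
  by rewrite doubleS exprS mulrA xq -exprD mulN1r addnS -addnn.
have e2 : (-1) ^+ (h.+2 + L)./2 = - (-1) ^+ (h + L)./2 :> R by rewrite !addSn /= exprS mulN1r.
by rewrite e e2 /= !subn0; ring.
Qed.

(** Here the down weight is -q (q^(h-1) [h])^2, so after the change of gauge each down step leaves a
    factor -q. *)
Lemma qperm_derangement_ladder L h :
  qperm q (h + L) (board (-1) 1
     (fun i j => if (i < j)%N then -1 else if i == j then 0 else 1) h h)
  = (- q) ^+ (h + L)./2 * gauge h * ladder 1 h.+1 L.
Proof.
elim: L h => [|L IH] h.
  case: h => [|h].
    by rewrite qperm0 /gauge /= big_ord0 expr0; ring.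
  rewrite addn0 qperm_row0 => [|j jh]; last by rewrite /board ltn0Sn jh.
  by rewrite /=; ring.
rewrite addnS qperm_derangement_step ?leq_addr //.
have -> : (h + L).+1 = (h.+1 + L)%N by [].
rewrite IH [in RHS]/ladder -/ladder !subn1 /=.
case: h => [|h]; first by rewrite !qnat0 gaugeS /=; ring.
rewrite IH !gaugeS.
have e : q ^+ (h.+1).*2.-1 = q * q ^+ h * q ^+ h by rewrite doubleS /= -exprS -exprD -addnn.
have e2 : (- q) ^+ (h.+2 + L)./2 = - q * (- q) ^+ (h + L)./2 by rewrite !addSn /= exprS.
by rewrite addSn e e2 /=; ring.
Qed.

(** Each step changes [m] by one and the final value must be [e]. The truncated predecessor of 0
    does no harm, its weight being [0]. *)
Lemma ladder_odd_eq0 e r m : odd (m + r + e) -> ladder e m r = 0.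
Proof.
elim: r m => [|r IH] m /=.
  by case: eqP => // ->; rewrite addn0 addnn odd_double.
move=> odd_mr; rewrite IH; last by rewrite addSnnS.
case: m odd_mr => [|m] odd_mr; first by rewrite sub0n qnat0; ring.
by rewrite IH ?mulr0 ?addr0 //; move: odd_mr; rewrite addnS !addSn /= negbK.
Qed.

Lemma sum_exc_inv_ladder x n : x * q = -1 ->
  \sum_(s : 'S_n.+1) x ^+ exc s * q ^+ invnum s
  = (-1) ^+ n./2 * ladder 0 1 n.+1.
Proof.
move=> xq; pose g i j := if (i < j)%N then x else 1.
transitivity (qperm q n.+1 (board x 1 g 0 0)).
  apply: eq_bigr => s _; rewrite mulrC; congr (_ * _).
  rewrite /board /exc /= -big_mkcond /= prodr_const; congr (_ ^+ _).
  by apply: eq_card => i; rewrite inE unfold_in /= !subn0.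
(* The value 0 is never an excedance, so column 0 is constant. It is read alone, which pairs row [k]
   with column [k+1] from then on. *)
rewrite (@qperm_col R q x 1 1 g) //; last by right.
rewrite subrr mul0r qnat0 !(mulr0, mul0r) !add0r.
by rewrite (qperm_weak_ladder n 0 xq) /gauge big_ord0 mulr1.
Qed.

Lemma sum_derangement_ladder n :
  \sum_(s : 'S_n | derangement s) (-1) ^+ exc s * q ^+ invnum s
  = (- q) ^+ n./2 * ladder 1 1 n.
Proof.
have := qperm_derangement_ladder n 0; rewrite /gauge big_ord0 mulr1 => <-.
rewrite /qperm big_mkcond /=; apply: eq_bigr => s _; case: ifP => [/forallP der|].
  rewrite mulrC; congr (_ * _); rewrite /board /exc /=.
  rewrite -prodr_const big_mkcond /=; apply: eq_bigr => i _.
  by rewrite !subn0 inE; case: ifP => // _; rewrite (inj_eq val_inj) eq_sym (negbTE (der i)).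
move/negbT; rewrite negb_forall => /existsP[i]; rewrite negbK => /eqP si.
by rewrite (bigD1 i) //= /board si /= ltnn eqxx mul0r mulr0.
Qed.

End LeftHandSides.

Local Close Scope ring_scope.

(** * Alternating words with blocks *)

Section Words.
Variables (B : nat) (e : bool).
Implicit Types (u v w : seq nat) (r : rel nat).

Fixpoint adj r w : nat :=
  if w is x :: w' then (~~ nilp w' && r x (head 0 w')) + adj r w' else 0.

Definition alt_step (b : bool) x y := if b then y < x else x < y.

Fixpoint alternating b w : bool :=
  if w is x :: w' then (nilp w' || alt_step b x (head 0 w')) && alternating (~~ b) w'
  else true.

(* [B] is the block letter; it is meant to exceed every other letter. *)
Fixpoint collapse k w :=
  if w is x :: w' then
    let c := collapse k w' in
    if x < k then x :: c else if ~~ nilp c && (head 0 c == B) then c else B :: c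
  else [::].

Definition descends_across c x y := y < c < x.
Definition ascends_across c x y := x < c < y.

(* The patterns in which [k] plays the role of 2; [e] selects 2-31 against 2-13. *)
Definition contrib k w :=
  adj (descends_across k) (take (index k w) w)
  + 2 * adj (if e then descends_across k else ascends_across k) (drop (index k w).+1 w).

Definition small k w := all (fun x => (x < k) || (x == B)) w.
Definition last_lt u c := nilp u || (last 0 u < c).
Definition head_lt v c := nilp v || (head 0 v < c).

(* When [e] holds the word ends with a block that no letter may replace: it
   stands for the letter appended to a word of even length. *)
Definition good k w :=
  [&& alternating true w, odd (size w), small k w,
      all (fun l => count_mem l w == 1) (iota 0 k) & e ==> (last 0 w == B)].

(* What [good] says about [u] and [v] for each of the words [u ++ B :: v],
   [u ++ k :: v] and [u ++ [:: B, k, B & v]]. *)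
Definition context k u v :=
  [&& ~~ odd (size u), ~~ odd (size v), alternating true u, last_lt u k,
      head_lt v k, alternating false v, small k u, small k v
    & all (fun l => count_mem l u + count_mem l v == 1) (iota 0 k)].

Fixpoint splits w : seq (seq nat * seq nat) :=
  if w is x :: w' then
    (if x == B then [:: ([::], w')] else [::]) ++ [seq (x :: p.1, p.2) | p <- splits w']
  else [::].

Definition children k w :=
  [seq p.1 ++ k :: p.2 | p <- splits w & e ==> ~~ nilp p.2]
  ++ [seq p.1 ++ [:: B, k, B & p.2] | p <- splits w].

Lemma alternating_cat b u v :
  alternating b (u ++ v) = [&& alternating b u, alternating (b (+) odd (size u)) v &
    [|| nilp u, nilp v | alt_step (~~ (b (+) odd (size u))) (last 0 u) (head 0 v)]].
Proof.
elim: u b => [|x u IH] b; first by rewrite /= addbF andbT.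
rewrite cat_cons /= IH addNb -addbN; case: u {IH} => [|y u] /=; last by rewrite andbA.
by rewrite !addbT negbK; case: v => [|y v] //=; rewrite ?andbT // andbC.
Qed.

Lemma alternating_peak c u v : ~~ odd (size u) ->
  alternating true (u ++ c :: v) =
  [&& alternating true u, last_lt u c, head_lt v c & alternating false v].
Proof.
move=> /negbTE su; rewrite alternating_cat su /= /last_lt /head_lt.
by case: (alternating true u) => //=; rewrite andbC.
Qed.

Lemma all_iotaS (p : pred nat) k : all p (iota 0 k.+1) = all p (iota 0 k) && p k.
Proof. by rewrite -addn1 iotaD all_cat /= andbT. Qed.

Lemma notin_count k w : (k \notin w) = (count_mem k w == 0).
Proof. by apply/idP/eqP => [/count_memPn|/count_memPn]. Qed.

Lemma small_cat k u v : small k (u ++ v) = small k u && small k v.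
Proof. exact: all_cat. Qed.

Lemma last_ltB k u : k <= B -> small k u -> last_lt u B = last_lt u k.
Proof.
move=> kB; rewrite /last_lt; case/lastP: u => // u x.
rewrite /small all_rcons last_rcons => /andP[h _].
by rewrite /nilp size_rcons /=; lia.
Qed.

Lemma head_ltB k v : k <= B -> small k v -> head_lt v B = head_lt v k.
Proof. by move=> kB; rewrite /head_lt; case: v => //= x v /andP[h _]; lia. Qed.

Lemma smallS k w : k < B -> small k.+1 w && (k \notin w) = small k w.
Proof.
move=> kB; elim: w => //= x w IH; rewrite inE negb_or -IH.
by case: (small _ w) (k \in w) => [] []; rewrite /= ?andbF ?andbT //; lia.
Qed.

Lemma good_block k u v : k <= B -> ~~ odd (size u) ->
  good k (u ++ B :: v) = context k u v && (e ==> (last B v == B)).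
Proof.
move=> kB su; rewrite /good /context alternating_peak // size_cat /= oddD /= su.
rewrite (negbTE su) /= small_cat /= eqxx orbT last_cat /=.
have -> : all (fun l => count_mem l (u ++ B :: v) == 1) (iota 0 k) =
  all (fun l => count_mem l u + count_mem l v == 1) (iota 0 k).
  apply: eq_in_all => l; rewrite mem_iota /= => lk; rewrite count_cat /=.
  by have -> : (B == l) = false by lia.
case su': (small k u); last by rewrite !(andbF, andFb).
case sv': (small k v); last by rewrite !(andbF, andFb).
rewrite (last_ltB kB su') (head_ltB kB sv') /=.
by case: (odd (size v)); rewrite ?andbF //= -!andbA.
Qed.

(** At an odd position the preceding letter would have to exceed [B], the largest letter. *)
Lemma good_block_even k u v : k <= B -> good k (u ++ B :: v) -> ~~ odd (size u).
Proof.
move=> kB /and5P[alt _ sm _ _]; apply/negP => su.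
move: alt; rewrite alternating_cat su /= => /and3P[_ _].
case/lastP: u su sm => // u x _; rewrite small_cat last_rcons /alt_step.
rewrite /nilp size_rcons /= /small all_rcons => /andP[/andP[+ _] _]; lia.
Qed.

(** The default in [last k v] differs from [B], so under [e] the word [v] is nonempty: the final
    block never becomes a peak. *)
Lemma good_peak k u v : k < B -> ~~ odd (size u) ->
  good k.+1 (u ++ k :: v) = context k u v && (e ==> (last k v == B)).
Proof.
move=> kB su; rewrite /good /context all_iotaS alternating_peak // size_cat /= oddD /= su.
rewrite (negbTE su) /= small_cat /= ltnSn last_cat.
have -> : all (fun l => count_mem l (u ++ k :: v) == 1) (iota 0 k) =
  all (fun l => count_mem l u + count_mem l v == 1) (iota 0 k).
  apply: eq_in_all => l; rewrite mem_iota /= => lk; rewrite count_cat /=.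
  by have -> : (k == l) = false by lia.
rewrite -[small k u]smallS // -[small k v]smallS //.
have -> : (count_mem k (u ++ k :: v) == 1) = (k \notin u) && (k \notin v).
  by rewrite count_cat /= eqxx !notin_count -[nat_of_bool true]/1 addnCA eqSS addn_eq0.
rewrite last_cons /=; btauto.
Qed.

Lemma good_valley k u v : k < B -> ~~ odd (size u) ->
  good k.+1 (u ++ [:: B, k, B & v]) = context k u v && (e ==> (last B v == B)).
Proof.
move=> kB su; rewrite /good /context all_iotaS alternating_peak // size_cat /= oddD /= su.
rewrite (negbTE su) /= small_cat /= ltnSn eqxx !orbT /= last_cat.
have -> : all (fun l => count_mem l (u ++ [:: B, k, B & v]) == 1) (iota 0 k) =
  all (fun l => count_mem l u + count_mem l v == 1) (iota 0 k).
  apply: eq_in_all => l; rewrite mem_iota /= => lk; rewrite count_cat /=.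
  have -> : (k == l) = false by lia.
  by have -> : (B == l) = false by lia.
have -> : (count_mem k (u ++ [:: B, k, B & v]) == 1) = (k \notin u) && (k \notin v).
  rewrite count_cat /= eqxx !notin_count -[nat_of_bool true]/1.
  have -> : (B == k) = false by lia.
  by rewrite !add0n addnCA eqSS addn_eq0.
transitivity ([&& ~~ odd (size v), alternating true u, last_lt u B,
      head_lt v B, alternating false v, small k u, small k v
    & all (fun l => count_mem l u + count_mem l v == 1) (iota 0 k)]
    && (e ==> (last B v == B))).
  by rewrite -(smallS u kB) -(smallS v kB) kB last_cons /head_lt /= kB; btauto.
case Eu: (small k u); last by rewrite !andbF.
case Ev: (small k v); last by rewrite !andbF.
by rewrite (last_ltB (ltnW kB) Eu) (head_ltB (ltnW kB) Ev).
Qed.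

(** At an even position [k] is a peak. At an odd one it is a valley, not the last letter since the
    length is odd, and its neighbours exceed [k], hence are blocks. *)
Lemma good_splitS k w : k < B -> good k.+1 w ->
  exists u v, ~~ odd (size u) /\ (w = u ++ k :: v \/ w = u ++ [:: B, k, B & v]).
Proof.
move=> kB gw; have : k \in w.
  case/and5P: gw => _ _ _ + _; rewrite all_iotaS => /andP[_ /eqP ck].
  by rewrite -has_pred1 has_count ck.
move=> kw; move: gw; case/splitPr: kw => u v gw.
case su: (odd (size u)); last by exists u, v; split; [rewrite su | left].
case/and5P: gw => alt sz sm _ _.
move: sm; rewrite small_cat => /andP[smu /andP[_ smv]].
move: alt; rewrite alternating_cat su /= => /and3P[_ /andP[hv _] hu].
case/lastP: u su smu hu sz => // u x; rewrite size_rcons /= => /negbTE su.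
rewrite /small all_rcons last_rcons /nilp size_rcons /alt_step /= => /andP[smx _] kx.
rewrite size_cat size_rcons oddD /= su /=.
case: v hv smv => [|y v] //=; rewrite /alt_step => ky /andP[smy _] _.
have -> : x = B by lia.
have -> : y = B by lia.
by exists u, v; rewrite su cat_rcons; split=> //; right.
Qed.

Lemma mem_splits w u v : ((u, v) \in splits w) = (w == u ++ B :: v).
Proof.
elim: w u v => [|x w IH] u v; first by case: u.
rewrite /= mem_cat; case: u => [|y u] /=.
  rewrite eqseq_cons; set s := map _ _.
  have -> : (([::], v) \in s) = false by apply/mapP => -[].
  by rewrite orbF; case: eqP => _; rewrite ?inE ?xpair_eqE //= eq_sym.
rewrite eqseq_cons (_ : (y :: u, v) \in (if _ then _ else _) = false); last by case: ifP.
apply/mapP/andP => [[[u' v'] + [-> -> ->]]|[/eqP -> h]]; first by rewrite IH.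
by exists (u, v); rewrite // IH.
Qed.

Lemma splits_uniq w : uniq (splits w).
Proof.
elim: w => //= x w IH; rewrite cat_uniq map_inj_uniq ?IH => [|[a b] [c d] [-> ->] //].
rewrite andbT; apply/andP; split; first by case: ifP.
by apply/hasPn => _ /mapP[p _ ->]; case: ifP.
Qed.

Lemma big_splits (R : Type) (idx : R) (op : Monoid.law idx) w (f : nat -> nat -> R) :
  \big[op/idx]_(p <- splits w) f (count_mem B p.1) (count_mem B p.2) =
  \big[op/idx]_(i < count_mem B w) f i ((count_mem B w).-1 - i).
Proof.
elim: w f => [|x w IH] f /=; first by rewrite big_nil big_ord0.
rewrite big_cat big_map /= (IH (fun i => f ((x == B) + i))).
case: eqP => _ /=; last by rewrite big_nil Monoid.mul1m.
rewrite big_seq1 big_ord_recl /= subn0; congr (op _ _).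
by apply: eq_bigr => i _; congr f; rewrite /bump /=; lia.
Qed.

Lemma collapse_id k b w : k <= B -> small k w -> alternating b w -> collapse k w = w.
Proof.
move=> kB; elim: w b => //= x w IH b /andP[sx sw] /andP[hx aw].
rewrite (IH _ sw aw); case: ltnP => // kx; have -> : x = B by lia.
case: w hx sw {IH aw} => //= y w; rewrite /alt_step => hx /andP[sy _].
by case: ifP => // /eqP yB; move: hx; case: b; lia.
Qed.

Lemma collapse_cons_small k x u v : x < k -> k <= B ->
  collapse k (u ++ x :: v) = collapse k u ++ x :: collapse k v.
Proof.
move=> xk kB; elim: u => [|y u IH] /=; first by rewrite xk.
rewrite IH; case: ltnP => // ky; case: (collapse k u) => [|z t] /=.
  by have -> : (x == B) = false by lia.
by case: ifP.
Qed.

Lemma collapse_cat k u v : k <= B -> last_lt u k ->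
  collapse k (u ++ v) = collapse k u ++ collapse k v.
Proof.
move=> kB; case/lastP: u => // u x; rewrite /last_lt last_rcons /nilp size_rcons /= => xk.
by rewrite cat_rcons -cats1 !collapse_cons_small // -catA.
Qed.

Lemma nilp_collapse k w : nilp (collapse k w) = nilp w.
Proof. by case: w => //= x w; case: ifP => // _; case: ifP => // /andP[/negbTE]. Qed.

Lemma head_collapse k x w :
  head 0 (collapse k (x :: w)) = if x < k then x else B.
Proof. by move=> /=; case: ifP => // _; case: ifP => // /andP[_ /eqP]. Qed.

Lemma mem_collapse k x w : x \in collapse k w -> x = B \/ x \in w.
Proof.
elim: w => //= y w IH; case: ifP => _; last case: ifP => _; rewrite ?inE.
- by case/orP => [->|/IH[]]; [right | left | move=> ->; right; rewrite orbT].
- by move=> /IH[]; [left | move=> ->; right; rewrite orbT].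
- by case/orP => [/eqP|/IH[]]; [left | left | move=> ->; right; rewrite orbT].
Qed.

Lemma collapse_collapse k l w : k <= l -> l <= B ->
  collapse k (collapse l w) = collapse k w.
Proof.
move=> kl lB; elim: w => //= x w IH; case: ltnP => xl /=; first by rewrite IH.
have xk : (x < k) = false by lia.
have Bk : (B < k) = false by lia.
rewrite xk; case: ifP => [|_] /=; last by rewrite IH Bk.
rewrite -IH; case: (collapse l w) => //= y t /eqP ->.
by rewrite Bk; case: ifP => [|_]; [case/andP=> -> -> | rewrite eqxx].
Qed.

(** [r] sees a letter only through its image under the collapse, and pairs inside a run become
    [r B B], which is false. *)
Lemma adj_collapse k r w : ~~ r B B ->
  (forall x y, r x y = r (if x < k then x else B) (if y < k then y else B)) ->
  adj r (collapse k w) = adj r w.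
Proof.
move=> rBB rE; elim: w => // x w IH; rewrite [collapse _ _]/= [adj r (x :: w)]/=.
have hd y : (~~ nilp w && r y (head 0 w)) =
    (~~ nilp (collapse k w) && r (if y < k then y else B) (head 0 (collapse k w))).
  by rewrite nilp_collapse; case: (w) => // z t; rewrite head_collapse -rE.
rewrite hd -IH; case: ifP => // xk; case: ifP => //= /andP[-> /eqP ->].
by rewrite (negbTE rBB).
Qed.

(** Only blocks lie above [k], and each block is followed by a letter below [k] unless it ends the
    word. *)
Lemma adj_descends k b w : k < B -> small k w -> alternating b w ->
  adj (descends_across k) w + (last 0 w == B) = count_mem B w.
Proof.
move=> kB; elim: w b => [|x w IH] b /=; first by move=> _ _; lia.
move=> /andP[sx sw] /andP[hx aw]; rewrite -(IH _ sw aw).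
case: w hx sw {IH aw} => [|y w] /= hx sw.
  by rewrite [0 == B]ltn_eqF ?(leq_ltn_trans _ kB) // !addn0.
rewrite -addnA; congr (nat_of_bool _ + _).
move: hx sw; rewrite /descends_across /alt_step /= => hx /andP[sy _].
by move: hx; case: b; lia.
Qed.

Lemma adj_ascends k b w : k < B -> small k w -> alternating b w ->
  adj (ascends_across k) w + (head 0 w == B) = count_mem B w.
Proof.
move=> kB; elim: w b => [|x w IH] b /=; first by move=> _ _; lia.
move=> /andP[sx sw] /andP[hx aw]; rewrite -(IH _ sw aw).
case: w hx sw {IH aw} => [|y w] /= hx sw.
  by rewrite [0 == B]ltn_eqF ?(leq_ltn_trans _ kB) // !addn0.
suff -> : ascends_across k x y = (y == B).
  by rewrite [LHS]addnC [in LHS](addnC (nat_of_bool (y == B))).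
move: hx sw; rewrite /ascends_across /alt_step /= => hx /andP[sy _].
by move: hx; case: b; lia.
Qed.

Lemma contrib_cat k u v : k \notin u ->
  contrib k (u ++ k :: v) = adj (descends_across k) u
    + 2 * adj (if e then descends_across k else ascends_across k) v.
Proof.
move=> ku; rewrite /contrib index_cat (negbTE ku) /= eqxx addn0 take_size_cat //.
by rewrite -cat_rcons drop_size_cat // size_rcons.
Qed.

(** Letters merged into a block were above [k] and stay above it, so crossings of [k] survive. *)
Lemma contrib_collapse k w : k < B -> k \in w ->
  contrib k (collapse k.+1 w) = contrib k w.
Proof.
move=> kB kw; have [u [v [-> ku]]] : exists u v, w = u ++ k :: v /\ k \notin u.
  exists (take (index k w) w), (drop (index k w).+1 w); split.
    by rewrite -{2}(nth_index 0 kw) -drop_nth ?index_mem // cat_take_drop.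
  by rewrite in_take // ltnn.
rewrite collapse_cons_small // !contrib_cat //; last first.
  by apply: contra ku => /mem_collapse[kE|//]; move: kB; rewrite kE ltnn.
have d x y : descends_across k x y = descends_across k (if x < k.+1 then x else B)
    (if y < k.+1 then y else B).
  by rewrite /descends_across; case: (ltnP x k.+1); case: (ltnP y k.+1); lia.
have a x y : ascends_across k x y = ascends_across k (if x < k.+1 then x else B)
    (if y < k.+1 then y else B).
  by rewrite /ascends_across; case: (ltnP x k.+1); case: (ltnP y k.+1); lia.
have dB : ~~ descends_across k B B by rewrite /descends_across; lia.
have aB : ~~ ascends_across k B B by rewrite /ascends_across; lia.
by case: e; rewrite !adj_collapse.
Qed.

End Words.

(** * Children of a good word: the fibres of one collapsing step *)

Section Children.
Variables (B : nat) (e : bool).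
Implicit Types (u v w z : seq nat).

Lemma collapse_peak k u v : k < B -> context B k u v ->
  collapse B k (u ++ k :: v) = u ++ B :: v.
Proof.
move=> kB /and5P[_ _ au lu /and5P[hv av su sv _]]; have kB' := ltnW kB.
rewrite collapse_cat // (collapse_id kB' su au) /= ltnn (collapse_id kB' sv av).
by case: v hv {sv av} => //= y v; rewrite /head_lt /= => yk; rewrite ltn_eqF // (ltn_trans yk).
Qed.

Lemma collapse_valley k u v : k < B -> context B k u v ->
  collapse B k (u ++ [:: B, k, B & v]) = u ++ B :: v.
Proof.
move=> kB /and5P[_ _ au lu /and5P[hv av su sv _]]; have kB' := ltnW kB.
rewrite collapse_cat // (collapse_id kB' su au) /= ltnn (collapse_id kB' sv av).
rewrite ltnNge kB' /=.
by case: v hv {sv av} => [|y v]; rewrite /head_lt /= ?eqxx //= => yk;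
   rewrite ltn_eqF /= ?eqxx // (ltn_trans yk).
Qed.

Lemma last_neqB k v : k < B -> (last k v == B) = ~~ nilp v && (last B v == B).
Proof. by case: v => //= kB; rewrite ltn_eqF. Qed.

Lemma good_split k w u v : k <= B -> good B e k w -> (u, v) \in splits B w ->
  [/\ w = u ++ B :: v, context B k u v & e ==> (last B v == B)].
Proof.
move=> kB gw; rewrite mem_splits => /eqP wE; rewrite wE in gw *.
have su := good_block_even kB gw; by move: gw; rewrite good_block // => /andP[].
Qed.

Lemma context_even k u v : context B k u v -> ~~ odd (size u).
Proof. by case/andP. Qed.

(** Together with [children_collapse] this identifies the children of [w] with the good words one
    level up that collapse to [w]. *)
Lemma good_children k w z : k < B -> good B e k w -> z \in children B e k w ->
  good B e k.+1 z /\ collapse B k z = w.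
Proof.
move=> kB gw; rewrite mem_cat => /orP[] /mapP[[u v]] /=.
  rewrite mem_filter /= => /andP[ev /(good_split (ltnW kB) gw)[-> cuv lv]] ->.
  rewrite good_peak ?(context_even cuv) // cuv collapse_peak // last_neqB //=.
  by move: ev lv; case: e => //= -> ->.
move=> /(good_split (ltnW kB) gw)[-> cuv lv] ->.
by rewrite good_valley ?(context_even cuv) // cuv collapse_valley.
Qed.

Lemma children_collapse k z : k < B -> good B e k.+1 z ->
  good B e k (collapse B k z) /\ z \in children B e k (collapse B k z).
Proof.
move=> kB gz; have [u [v [su [zE|zE]]]] := good_splitS kB gz; subst z.
  move: gz; rewrite good_peak // => /andP[cuv lv].
  rewrite collapse_peak // good_block ?(ltnW kB) // cuv /=.
  move: lv; rewrite last_neqB // => lv; split; first by move: lv; case: e => //= /andP[].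
  rewrite mem_cat; apply/orP; left; apply/mapP; exists (u, v) => //.
  by rewrite mem_filter mem_splits eqxx andbT /=; move: lv; case: e => //= /andP[].
move: gz; rewrite good_valley // => /andP[cuv lv].
rewrite collapse_valley // good_block ?(ltnW kB) // cuv /=; split=> //.
rewrite mem_cat; apply/orP; right; apply/mapP; exists (u, v) => //.
by rewrite mem_splits.
Qed.

Lemma cat_notin_inj k u v u' v' : k \notin u -> k \notin u' ->
  u ++ k :: v = u' ++ k :: v' -> (u, v) = (u', v').
Proof.
move=> ku ku' E; have := congr1 (index k) E.
rewrite !index_cat (negbTE ku) (negbTE ku') /= eqxx !addn0 => su.
by move/eqP: E; rewrite eqseq_cat // => /andP[/eqP -> /eqP[->]].
Qed.

Lemma context_notin k u v : k < B -> context B k u v -> k \notin u /\ k \notin v.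
Proof.
move=> kB /and5P[_ _ _ _ /and5P[_ _ su sv _]].
by move: su sv; rewrite -!(smallS _ kB) => /andP[_ ->] /andP[_ ->].
Qed.

(** The position of [k] determines the split, and its parity tells peaks from valleys. *)
Lemma children_uniq k w : k < B -> good B e k w -> uniq (children B e k w).
Proof.
move=> kB gw; have spl u v := @good_split k w u v (ltnW kB) gw.
rewrite cat_uniq !map_inj_in_uniq ?filter_uniq ?splits_uniq //=; first 1 last.
- move=> [u v] [u' v'] /spl[_ c _] /spl[_ c' _] /=.
  rewrite -2![_ ++ [:: B, k, B & _]]cat_rcons => /cat_notin_inj E.
  have [ku _] := context_notin kB c; have [ku' _] := context_notin kB c'.
  have kB' : (k == B) = false by rewrite ltn_eqF.
  rewrite !mem_rcons !inE kB' /= in E; case: (E ku ku') => + ->.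
  by move/rcons_inj => [->].
- move=> [u v] [u' v']; rewrite !mem_filter => /andP[_ /spl[_ c _]] /andP[_ /spl[_ c' _]] /=.
  have [ku _] := context_notin kB c; have [ku' _] := context_notin kB c'.
  exact: cat_notin_inj.
rewrite andbT; apply/hasPn => _ /mapP[[u v] /spl[_ c _] ->] /=.
apply/mapP => -[[u' v']]; rewrite mem_filter => /andP[_ /spl[_ c' _]] /=.
rewrite -cat_rcons => /cat_notin_inj E.
have [ku _] := context_notin kB c; have [ku' _] := context_notin kB c'.
have kB' : (k == B) = false by rewrite ltn_eqF.
rewrite mem_rcons inE kB' /= in E; case: (E ku ku') => uE _.
by have := context_even c'; rewrite -uE size_rcons /= negbK => h; have := context_even c; rewrite h.
Qed.

Lemma contrib_peak k u v : k < B -> context B k u v -> e ==> (last k v == B) ->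
  contrib e k (u ++ k :: v) = count_mem B u + 2 * (count_mem B v - e).
Proof.
move=> kB c lv; have [ku _] := context_notin kB c; rewrite contrib_cat //.
case/and5P: c => _ _ au lu /and5P[hv av su sv _].
have := adj_descends kB su au; have -> : (last 0 u == B) = false.
  case/lastP: u lu {ku au su} => [|u x]; first by rewrite /=; lia.
  by rewrite /last_lt last_rcons /nilp size_rcons /=; lia.
rewrite addn0 => ->; congr (_ + 2 * _).
case: e lv => /= lv; last first.
  have := adj_ascends kB sv av; have -> : (head 0 v == B) = false.
    by case: v hv {lv sv av} => [|y v]; rewrite /head_lt /=; lia.
  by rewrite addn0 subn0.
rewrite -(adj_descends kB sv av); case: v lv {hv av sv} => [|y v] /=; first by lia.
by move=> ->; rewrite addnK.
Qed.

Lemma contrib_valley k u v : k < B -> context B k u v -> e ==> (last B v == B) ->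
  contrib e k (u ++ [:: B, k, B & v]) = count_mem B u + 2 * count_mem B v.
Proof.
move=> kB c lv; have [ku _] := context_notin kB c.
rewrite -cat_rcons contrib_cat ?mem_rcons ?inE ?negb_or ?(ltn_eqF kB) //.
case/and5P: c => eu _ au lu /and5P[hv av su sv _].
have su' : small B k (rcons u B) by rewrite /small all_rcons eqxx orbT.
have au' : alternating true (rcons u B).
  by rewrite -cats1 alternating_peak // au (last_ltB (ltnW kB) su) lu.
have := adj_descends kB su' au'; rewrite last_rcons eqxx -cats1 count_cat /= eqxx addn0.
move/addIn => ->; congr (_ + 2 * _).
have sv' : small B k (B :: v) by rewrite /= eqxx orbT.
have av' : alternating true (B :: v).
  by rewrite /= av andbT; move: hv; rewrite -(head_ltB (ltnW kB) sv).
case: e lv => /= lv.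
  by have := adj_descends kB sv' av'; rewrite /= lv eqxx [RHS]addnC => /addIn.
by have := adj_ascends kB sv' av'; rewrite /= eqxx [RHS]addnC => /addIn.
Qed.

End Children.

(** * The ladder recursion on words *)

Local Open Scope ring_scope.

(** The exponent is (m-1) + (m-1-i); reversing the index gives the geometric sum. *)
Lemma sum_geom2 (R : comNzRingType) (q : R) m :
  \sum_(i < m) q ^+ (i + 2 * (m.-1 - i)) = q ^+ m.-1 * qnat q m.
Proof.
rewrite /qnat mulr_sumr (reindex_inj rev_ord_inj) /=; apply: eq_bigr => i _.
by rewrite -exprD; congr (_ ^+ _); have := ltn_ord i; lia.
Qed.

(** Valley children have one block more and give the first term of [ladder]; peak children have one
    less and give the second. *)
Lemma sum_children (R : comNzRingType) (q : R) B (e : bool) k w r :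
  (k < B)%N -> good B e k w ->
  \sum_(z <- children B e k w) q ^+ contrib e k z * ladder q e (count_mem B z) r
  = ladder q e (count_mem B w) r.+1.
Proof.
move=> kB gw; have spl u v := @good_split B e k w u v (ltnW kB) gw.
rewrite big_cat !big_map /= addrC; set m := count_mem B w.
have mE u v : w = u ++ B :: v -> (count_mem B u + count_mem B v).+1 = m.
  by move=> wE; rewrite /m wE count_cat /= eqxx addnS.
congr (_ + _).
  pose f i j := q ^+ (i + 2 * j) * ladder q e m.+1 r.
  rewrite (eq_big_seq (fun p => f (count_mem B p.1) (count_mem B p.2))) /=; last first.
    move=> [u v] /spl[/= /mE wE c lv]; rewrite (contrib_valley kB c lv) /f -wE.
    rewrite !count_cat /= eqxx (ltn_eqF kB) /=; congr (_ * ladder _ _ _ _).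
    by rewrite add0n !add1n !addnS.
  by rewrite big_splits /f -mulr_suml sum_geom2.
pose f i j := if e ==> (0 < j)%N then q ^+ (i + 2 * (j - e)) * ladder q e m.-1 r else 0.
rewrite big_filter big_mkcond.
rewrite (eq_big_seq (fun p => f (count_mem B p.1) (count_mem B p.2))) /=; last first.
  move=> [u v] /spl[/= /mE wE c lv]; rewrite /f.
  have -> : (e ==> (0 < count_mem B v)%N) = (e ==> ~~ nilp v).
    move: lv; case: (e) => //=; case: v {wE c} => //= y v /eqP lv.
    by have := mem_last y v; rewrite lv -has_pred1 has_count => h; apply: h.
  case: ifP => // ev; rewrite (contrib_peak kB c); last first.
    by rewrite last_neqB //; move: ev lv; case: (e) => //= -> ->.
  by rewrite -wE !count_cat /= (ltn_eqF kB) add0n.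
rewrite big_splits -/m /f; case: (e); last first.
  rewrite -mulr_suml [nat_of_bool _]/= !subn0 -sum_geom2; congr (_ * _).
  by apply: eq_bigr => i _; rewrite subn0.
case: (m) => [|m'] /=; first by rewrite big_ord0 qnat0; ring.
(* The last index is the split at the final block, which [e] forbids. *)
rewrite big_ord_recr /= subnn /= addr0 (subn1 m') (subn1 m'.+1) /= -sum_geom2 mulr_suml.
apply: eq_bigr => i _; rewrite subn_gt0 ltn_ord; congr (_ ^+ _ * _).
by have := ltn_ord i; lia.
Qed.

Local Close Scope ring_scope.

(** * One-line words of permutations *)

Section PermutationWords.
Variable n : nat.
Implicit Type s : 'S_n.
Let e := ~~ odd n.

Definition one_line s : seq nat := [seq nat_of_ord (s i) | i <- enum 'I_n].

(** The block letter will be [n] itself, so the appended letter is a block from the start. *)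
Definition closed_word s : seq nat := one_line s ++ nseq e n.

Lemma size_one_line s : size (one_line s) = n.
Proof. by rewrite size_map size_enum_ord. Qed.

Lemma nth_one_line s (i : 'I_n) : nth 0 (one_line s) i = s i.
Proof. by rewrite (nth_map i) ?size_enum_ord // nth_ord_enum. Qed.

Lemma pv_one_line s k : pv s k = nth 0 (one_line s) k.
Proof.
rewrite /pv; case: insubP => [i _ <-|]; first by rewrite nth_one_line.
by rewrite -leqNgt => nk; rewrite nth_default // size_one_line.
Qed.

Lemma one_line_inj : injective one_line.
Proof.
move=> s t st; apply/permP => i; apply: val_inj.
by rewrite /= -!nth_one_line st.
Qed.

Lemma perm_one_line s : perm_eq (one_line s) (iota 0 n).
Proof.
apply: uniq_perm; rewrite ?iota_uniq //.
  by rewrite map_inj_uniq ?enum_uniq // => i j /val_inj /perm_inj.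
move=> x; rewrite mem_iota /= add0n; apply/mapP/idP => [[i _ ->] //|xn].
by exists ((s^-1)%g (Ordinal xn)); rewrite ?mem_enum // permKV.
Qed.

Lemma one_line_onto w : perm_eq w (iota 0 n) -> exists s, one_line s = w.
Proof.
move=> wn; have sw : size w = n by rewrite (perm_size wn) size_iota.
have uw : uniq w by rewrite (perm_uniq wn) iota_uniq.
have lt_n (i : 'I_n) : nth 0 w i < n.
  have : nth 0 w i \in w by rewrite mem_nth // sw.
  by rewrite (perm_mem wn) mem_iota.
have inj : injective (fun i => Ordinal (lt_n i)).
  move=> i j /(congr1 val) /= /eqP; rewrite nth_uniq ?sw // => /eqP; exact: val_inj.
exists (perm inj); apply: (@eq_from_nth _ 0); rewrite size_one_line ?sw // => i ilt.
by rewrite (nth_one_line _ (Ordinal ilt)) permE.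
Qed.

Lemma alternatingP b w :
  reflect (forall i, i.+1 < size w -> alt_step (b (+) odd i) (nth 0 w i) (nth 0 w i.+1))
    (alternating b w).
Proof.
apply: (iffP idP); elim: w b => // x w IH b /=.
  case/andP=> hx aw [|i] /=; first by case: w hx {IH aw}; rewrite /= addbF.
  by rewrite ltnS => /(IH _ aw); rewrite addNb addbN.
move=> h; rewrite IH => [|i hi]; last by have := h i.+1 hi; rewrite /= addNb addbN.
by rewrite andbT; case: w h {IH} => //= y w /(_ 0); rewrite addbF; apply.
Qed.

Lemma falt_alternating s : falt s = alternating true (one_line s).
Proof.
apply/forallP/alternatingP => [h i|h i]; rewrite size_one_line in h *.
  move=> hi; have := h (Ordinal (ltnW hi)).
  rewrite /= hi /= pv_one_line -nth_one_line /= /alt_step.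
  by case: odd.
apply/implyP => hi; have := h i hi.
by rewrite /= pv_one_line -nth_one_line /alt_step; case: odd.
Qed.

Lemma count_one_line s l : count_mem l (one_line s) = (l < n).
Proof.
rewrite (seq.permP (perm_one_line s)) count_uniq_mem ?iota_uniq //.
by rewrite mem_iota.
Qed.

Lemma mem_one_line s l : (l \in one_line s) = (l < n).
Proof. by rewrite (perm_mem (perm_one_line s)) mem_iota. Qed.

Lemma good_closed_word s : falt s -> good n e n (closed_word s).
Proof.
rewrite falt_alternating => alt; apply/and5P; split.
- rewrite alternating_cat alt size_one_line /=.
  rewrite /e; case: (boolP (odd n)) => on //=; first by rewrite orbT.
  case nu: (nilp (one_line s)) => //=.
  have nn : n.-1 < n by move: nu; rewrite /nilp size_one_line; lia.
  by rewrite /alt_step /= -nth_last size_one_line (nth_one_line _ (Ordinal nn)).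
- by rewrite size_cat size_one_line size_nseq oddD /e; case: (odd n).
- apply/allP => x; rewrite mem_cat mem_one_line mem_nseq => /orP[->//|/andP[_ ->]].
  by rewrite orbT.
- apply/allP => l; rewrite mem_iota /= add0n => ln.
  by rewrite count_cat count_one_line ln count_nseq /= (gtn_eqF ln) mul0n addn0.
by rewrite /closed_word; case: e => //; rewrite last_cat /=.
Qed.

Lemma good_word_onto w : good n e n w -> count_mem n w = e ->
  exists2 s, falt s & closed_word s = w.
Proof.
move=> gw cw; have [w' wE] : exists w', w = w' ++ nseq e n.
  case/and5P: gw => _ + _ _; case: e => [|_ _]; last by exists w; rewrite cats0.
  by case/lastP: (w) => // w' x _; rewrite last_rcons => /eqP ->; exists w'; rewrite cats1.
have cw' : count_mem n w' = 0.
  by move: cw; rewrite wE count_cat count_nseq /= eqxx mul1n -[RHS]add0n => /addIn.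
case/and5P: gw => alt _ sm /allP cnt _.
have [s sE] : exists s, one_line s = w'.
  (* [perm_eq] unfolds to equal counts for all letters of either word. *)
  apply: one_line_onto; apply/allP => l; rewrite mem_cat => lw.
  have ln : l < n.
    case/orP: lw => [lw|]; last by rewrite mem_iota.
    have /orP[//|/eqP lE] : (l < n) || (l == n).
      by move/allP: sm; apply; rewrite wE mem_cat lw.
    by move/count_memPn: cw'; rewrite -lE lw.
  have := cnt l; rewrite mem_iota /= ln => /(_ isT).
  rewrite wE count_cat count_nseq /= (gtn_eqF ln) mul0n addn0 => /eqP ->.
  by rewrite count_uniq_mem ?iota_uniq // mem_iota /= add0n ln.
exists s; last by rewrite /closed_word sE.
by rewrite falt_alternating sE; move: alt; rewrite wE alternating_cat => /and3P[].
Qed.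

Lemma good_collapse s k : falt s -> k <= n -> good n e k (collapse n k (closed_word s)).
Proof.
move=> fs; elim: {k}(n - k) {-2}k (erefl (n - k)) => [|r IH] k kr kn.
  have -> : k = n by lia.
  have gw := good_closed_word fs; case/and5P: (gw) => alt _ sm _ _.
  by rewrite (collapse_id (leqnn n) sm alt).
rewrite -(@collapse_collapse n k k.+1) //; last by lia.
by apply: (children_collapse _ _).1; [lia | apply: IH; lia].
Qed.

Lemma contrib_closed_word s k : k < n ->
  contrib e k (closed_word s) = contrib e k (collapse n k.+1 (closed_word s)).
Proof. by move=> kn; rewrite contrib_collapse // mem_cat mem_one_line kn. Qed.

(** * Summation over the fibres of the collapse *)

Local Open Scope ring_scope.

(** The fibre over [w] splits according to the collapse at [k.+1], a child of [w], which already
    determines the contribution of the letter [k]. *)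
Lemma sum_fiber (R : comNzRingType) (q : R) r k w : (k + r = n)%N -> good n e k w ->
  \sum_(s : 'S_n | falt s && (collapse n k (closed_word s) == w))
     q ^+ (\sum_(k <= l < n) contrib e l (closed_word s))
  = ladder q e (count_mem n w) r.
Proof.
elim: r k w => [|r IH] k w kr gw.
  move: kr gw; rewrite addn0 => -> gw.
  under eq_bigl => s.
    have -> : falt s && (collapse n n (closed_word s) == w) = falt s && (closed_word s == w).
      case: (boolP (falt s)) => //= fs; case/and5P: (good_closed_word fs) => alt _ sm _ _.
      by rewrite (collapse_id (leqnn n) sm alt).
    over.
  under eq_bigr do rewrite big_geq // expr0.
  (* At level [n] a good word comes from a permutation exactly when its only block, if any, is the
     appended letter. *)
  rewrite /=; case: eqP => [cw|cw].
    have [s fs sE] := good_word_onto gw cw.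
    rewrite (big_pred1 s) // => t; apply/andP/eqP => [[_ /eqP tE]|->]; last by rewrite fs sE.
    apply: one_line_inj; move: tE; rewrite -sE => /eqP.
    by rewrite eqseq_cat ?size_one_line // => /andP[/eqP].
  rewrite big1 // => s /andP[_ /eqP sE]; case: cw.
  by rewrite -sE count_cat count_one_line ltnn count_nseq /= eqxx mul1n.
have kn : (k < n)%N by lia.
rewrite -(sum_children _ _ kn gw).
(* For [s] in the fibre exactly one child contributes, for any other [s] none. *)
transitivity (\sum_(s : 'S_n | falt s) \sum_(z <- children n e k w)
    (if collapse n k.+1 (closed_word s) == z then
      q ^+ contrib e k z * q ^+ (\sum_(k.+1 <= l < n) contrib e l (closed_word s)) else 0)).
  rewrite big_mkcondr; apply: eq_bigr => s fs.
  set z0 := collapse n k.+1 (closed_word s).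
  have cc : collapse n k z0 = collapse n k (closed_word s) by rewrite collapse_collapse.
  have gz0 : good n e k.+1 z0 by apply: good_collapse.
  case: eqP => sw.
    have [_] := children_collapse kn gz0; rewrite cc sw => z0w.
    rewrite (bigD1_seq z0) ?(children_uniq kn gw) //= eqxx [X in _ = _ + X]big1 => [|z].
      by rewrite addr0 big_ltn // exprD contrib_closed_word.
    by rewrite eq_sym => /negbTE ->.
  rewrite big_seq big1 // => z zw; case: eqP => // z0z; case: sw.
  by rewrite -cc z0z; have [] := good_children kn gw zw.
rewrite exchange_big /=; apply: eq_big_seq => z zw.
rewrite -(IH k.+1) ?addSnnS //; last by have [] := good_children kn gw zw.
by rewrite mulr_sumr -big_mkcondr.
Qed.

Lemma sum_falt_ladder (R : comNzRingType) (q : R) : (0 < n)%N ->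
  \sum_(s : 'S_n | falt s) q ^+ (\sum_(0 <= l < n) contrib e l (closed_word s))
  = ladder q e 1 n.
Proof.
move=> n0; have gB : good n e 0 [:: n] by rewrite /good /= eqxx implybT.
have := sum_fiber q (add0n n) gB; rewrite /= eqxx addn0 => <-; apply: eq_bigl => s.
case: (boolP (falt s)) => //= fs; have := good_collapse fs (leq0n n).
(* A good word at level 0 has only blocks, and two adjacent blocks would not alternate. *)
case: (collapse _ _ _) => [|x [|y w]] /and5P[alt sz sm _ _] //.
move: alt sm; rewrite /small /= /alt_step => /andP[yx _] /and3P[/eqP xn /eqP yn _].
by move: yx; rewrite xn yn ltnn.
Qed.

Local Close Scope ring_scope.

(** * From letter contributions to the pattern statistics *)

Lemma adj_sum (r : rel nat) w :
  adj r w = \sum_(0 <= i < (size w).-1) r (nth 0 w i) (nth 0 w i.+1).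
Proof.
elim: w => [|x w IH]; first by rewrite big_nil.
rewrite [adj _ _]/= IH; case: w {IH} => [|y w]; first by rewrite !big_nil.
by rewrite /= [RHS]big_nat_recl.
Qed.

(** The appended letter is never the bottom of a descent, so it creates no new 2-31. *)
Lemma adj_closed_suffix (r : rel nat) v : (e -> forall x, ~~ r x n) ->
  adj r (v ++ nseq e n) = adj r v.
Proof.
case: e => [/(_ isT) rn|_]; last by rewrite cats0.
elim: v => [|x v IH] //=; rewrite IH; case: v {IH} => //=.
by rewrite (negbTE (rn x)).
Qed.

Lemma contrib_perm s (j : 'I_n) : contrib e (s j) (closed_word s) =
  \sum_(i < n) [&& i.+1 < j, s j < s i & pv s i.+1 < s j]
  + 2 * \sum_(i < n) ((j.+1 < i) &&
      (if e then descends_across (s j) else ascends_across (s j)) (pv s i.-1) (s i)).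
Proof.
have idx : index (nat_of_ord (s j)) (one_line s) = j.
  rewrite -nth_one_line index_uniq ?size_one_line //.
  by rewrite (perm_uniq (perm_one_line s)) iota_uniq.
have drop_word : drop j.+1 (closed_word s) = drop j.+1 (one_line s) ++ nseq e n.
  rewrite drop_cat size_one_line; case: ltnP => // nj.
  have -> : j.+1 = n by have := ltn_ord j; lia.
  by rewrite subnn drop0 drop_oversize ?size_one_line.
rewrite /contrib {1 2}/closed_word index_cat mem_one_line ltn_ord idx drop_word.
rewrite take_cat size_one_line ltn_ord; congr (_ + 2 * _).
  rewrite adj_sum size_take size_one_line ltn_ord.
  rewrite (big_nat_widen _ _ n) ?big_mkord ?big_mkcond /=; last by have := ltn_ord j; lia.
  apply: eq_bigr => i _; have -> : (i < j.-1) = (i.+1 < j) by lia.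
  case: ltnP => // ij; rewrite !nth_take ?(ltnW ij) // nth_one_line -pv_one_line.
  by rewrite /descends_across andbC.
rewrite adj_closed_suffix => [|ee x]; last first.
  by rewrite ee /descends_across ltnNge ltnW ?ltn_ord.
rewrite adj_sum size_drop size_one_line; set r := (if e then _ else _).
(* Pairs after position [j] are indexed by their right end, which starts at [j.+2]. *)
transitivity (\sum_(0 <= i < n - j.+2)
    r (nth 0 (one_line s) (i + j.+2).-1) (nth 0 (one_line s) (i + j.+2))).
  rewrite (subnS n j.+1); apply: eq_bigr => i _; rewrite !nth_drop.
  by congr (nat_of_bool (r (nth _ _ _) (nth _ _ _))); lia.
rewrite -(big_addn 0 n j.+2 xpredT
  (fun i => r (nth 0 (one_line s) i.-1) (nth 0 (one_line s) i) : nat)).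
rewrite big_geq_mkord big_mkcond /=; apply: eq_bigr => i _.
by rewrite nth_one_line -pv_one_line; case: ltnP.
Qed.

Lemma card_pairs (P : 'I_n -> 'I_n -> bool) :
  #|[set p : 'I_n * 'I_n | P p.1 p.2]| = \sum_(j < n) \sum_(i < n) P i j.
Proof.
rewrite -sum1dep_card exchange_big pair_big /= big_mkcond /=.
by apply: eq_bigr => -[i j] _ /=; case: ifP.
Qed.

Lemma sum_contrib s : \sum_(0 <= l < n) contrib e l (closed_word s) =
  pat31_2 s + 2 * (if e then pat2_31 s else pat2_13 s).
Proof.
rewrite big_mkord (reindex_inj (@perm_inj _ s)) /=.
under eq_bigr do rewrite contrib_perm.
rewrite big_split -big_distrr /= -(card_pairs (fun i j => _)); congr (_ + 2 * _).
rewrite -(card_pairs (fun i j => (j.+1 < i) &&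
   (if e then descends_across (s j) else ascends_across (s j)) (pv s i.-1) (s i))).
rewrite /pat2_31 /pat2_13; case: e; apply: eq_card => p; rewrite !inE //.
by rewrite /descends_across [(s p.1 < _) && _]andbC.
Qed.

End PermutationWords.

(** * Comparison of the two sides *)

Local Open Scope ring_scope.

Theorem theorem1p3 (R : fieldType) (q : R) (hq : q != 0) (n : nat) (hn : (1 <= n)%N) :
  \sum_(s : 'S_n) (- q^-1) ^+ exc s * q ^+ invnum s =
    (if odd n then
       (-1) ^+ (n.-1)./2 * \sum_(s : 'S_n | falt s) q ^+ (pat31_2 s + 2 * pat2_13 s)
     else 0)
  /\
  \sum_(s : 'S_n | derangement s) (-1) ^+ exc s * q ^+ invnum s =
    (if ~~ odd n then
       (- q) ^+ n./2 * \sum_(s : 'S_n | falt s) q ^+ (pat31_2 s + 2 * pat2_31 s)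
     else 0).
Proof.
have altE : \sum_(s : 'S_n | falt s)
    q ^+ (pat31_2 s + 2 * (if ~~ odd n then pat2_31 s else pat2_13 s))
    = ladder q (~~ odd n) 1 n.
  by rewrite -(sum_falt_ladder q hn); apply: eq_bigr => s _; rewrite sum_contrib.
split.
  have xq : - q^-1 * q = -1 by rewrite mulNr mulVf.
  case: n hn altE => // n _ altE; rewrite (sum_exc_inv_ladder n xq).
  case: ifP altE => [odd_n -> // | odd_n _].
  by rewrite ladder_odd_eq0 ?mulr0 // addn0 add1n oddS odd_n.
rewrite sum_derangement_ladder.
case: ifP altE => [odd_n -> // | /negbFE odd_n _].
by rewrite ladder_odd_eq0 ?mulr0 // addn1 add1n !oddS negbK.
Qed.
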